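(* For every integer $m\ge 1$, let $P_m=\{(i,\sqrt2\,j): i,j\in\mathbb{Z},\ 0\le i,j\le m-1\}\subset\mathbb{R}^2$. Then every $4$-point subset of $P_m$ determines at least $3$ distinct pairwise Euclidean distances. *)

(* Defs.v *)
From mathcomp Require Import all_boot all_order all_algebra finmap.
From mathcomp Require Import classical_sets reals.

Set Implicit Arguments.
Unset Strict Implicit.
Unset Printing Implicit Defensive.

Import Order.TTheory GRing.Theory Num.Theory.
Local Open Scope ring_scope.
Local Open Scope fset_scope.

(* The norm that MathComp-Analysis puts on 'rV[R]_n is the sup norm, so the
   Euclidean distance is written out coordinatewise. *)
Definition edist (R : realType) (n : nat) (p q : 'rV[R]_n) : R :=
  Num.sqrt (\sum_(k < n) (p ord0 k - q ord0 k) ^+ 2).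

Definition vec2 (R : realType) (x y : R) : 'rV[R]_2 :=
  \row_(k < 2) (if k == ord0 then x else y).

Definition grid (R : realType) (m : nat) : set 'rV[R]_2 :=
  [set p | exists i j : int,
     [/\ 0 <= i <= m%:Z - 1, 0 <= j <= m%:Z - 1
       & p = vec2 i%:~R (Num.sqrt 2 * j%:~R)]]%classic.

(* Only pairs of distinct points count, so 0 is not a distance of S. *)
Definition distances (R : realType) (n : nat) (S : {fset 'rV[R]_n}) : {fset R} :=
  [fset edist p q | p in S, q in S & p != q].

(* Main.v *)
(** Squared distances in [P_m] are values of the integral form [x^2 + 2 y^2].
    Suppose that only two values [a] and [b] occur among four points.  In the
    resulting 2-colouring of the edges of [K_4] one finds a monochromatic
    triangle, or a monochromatic 4-cycle with both diagonals of the other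
    colour (a square), or two complementary monochromatic paths of length 3
    (four vertices of a regular pentagon).  Heron's formula and the vanishing of
    the Cayley-Menger determinant turn these cases into the equations
    [3 a^2 = 8 D^2], [2 D^2 = a^2] and [5 a^2 = (2 b - 3 a)^2], none of which
    has a solution in integers with [a <> 0]. *)

Require Import Defs.
From mathcomp Require Import all_boot all_order all_algebra finmap.
From mathcomp Require Import classical_sets reals.
From mathcomp Require Import ring zify.

Set Implicit Arguments.
Unset Strict Implicit.
Unset Printing Implicit Defensive.

Import Order.TTheory GRing.Theory Num.Theory.
Local Open Scope ring_scope.

(** If [x] were positive, the exponent of [p] would be odd on the left and, [p] not dividing [k],
    even on the right. *)
Lemma prime_mul_sqrn_eq0 (p k x y : nat) :
  prime p -> coprime p k -> (p * x ^ 2 = k * y ^ 2)%N -> x = 0%N.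
Proof.
move=> p_pr co_pk e; case: (posnP x) => // x_gt0.
have p_gt0 := prime_gt0 p_pr.
have : (0 < k * y ^ 2)%N by rewrite -e muln_gt0 p_gt0 expn_gt0 x_gt0.
rewrite muln_gt0 => /andP[k_gt0 y2_gt0].
have /(congr1 odd) : logn p (p * x ^ 2) = logn p (k * y ^ 2) by rewrite e.
have x2_gt0 : (0 < x ^ 2)%N by rewrite expn_gt0 x_gt0.
rewrite (lognM _ p_gt0 x2_gt0) (lognM _ k_gt0 y2_gt0) !lognX (logn_prime _ p_pr) eqxx.
by rewrite (logn_coprime co_pk) /= !oddM.
Qed.

Lemma prime_mul_sqrz_eq0 (p k : nat) (x y : int) :
  prime p -> coprime p k -> p%:Z * x ^+ 2 = k%:Z * y ^+ 2 -> x = 0.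
Proof.
move=> p_pr co_pk /(congr1 absz); rewrite (abszM p) (abszM k) !abszX => e.
by apply/eqP; rewrite -absz_eq0 (prime_mul_sqrn_eq0 p_pr co_pk e).
Qed.

(* The pair [(i, j)] stands for the point [(i, sqrt 2 * j)]. *)
Definition sqdist (p q : int * int) : int :=
  (p.1 - q.1) ^+ 2 + 2 * (p.2 - q.2) ^+ 2.

Lemma sqdistC p q : sqdist p q = sqdist q p.
Proof. by rewrite /sqdist; ring. Qed.

Lemma sqdist_ge0 p q : 0 <= sqdist p q.
Proof. by rewrite addr_ge0 ?sqr_ge0 // mulr_ge0 ?sqr_ge0. Qed.

Lemma sqdist_gt0 p q : p != q -> 0 < sqdist p q.
Proof.
move=> npq; rewrite lt0r sqdist_ge0 andbT; apply: contraNneq npq.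
move=> /eqP; rewrite paddr_eq0 ?sqr_ge0 //; last first.
  by rewrite mulr_ge0 ?sqr_ge0.
rewrite sqrf_eq0 subr_eq0 => /andP[/eqP e1].
rewrite mulf_eq0 /= sqrf_eq0 subr_eq0 => /eqP e2.
by apply/eqP/injective_projections.
Qed.

(** The Gram determinant of [q - p] and [r - p], times 4. The parenthesis squared is the determinant
    in index coordinates; the factor [sqrt 2] of the second axis turns 4 into 8. *)
Lemma sqdist_heron p q r :
  8 * ((q.1 - p.1) * (r.2 - p.2) - (q.2 - p.2) * (r.1 - p.1)) ^+ 2
  + (sqdist p q + sqdist p r - sqdist q r) ^+ 2
  = 4 * sqdist p q * sqdist p r.
Proof. by rewrite /sqdist; ring. Qed.

(* Twice the Gram matrix of [q - p], [r - p], [s - p] is singular, the three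
   vectors being coplanar. *)
Lemma sqdist_cayley_menger p q r s :
  let x := sqdist p q + sqdist p r - sqdist q r in
  let y := sqdist p q + sqdist p s - sqdist q s in
  let z := sqdist p r + sqdist p s - sqdist r s in
  4 * sqdist p q * sqdist p r * sqdist p s + x * y * z
  - sqdist p q * z ^+ 2 - sqdist p r * y ^+ 2 - sqdist p s * x ^+ 2 = 0.
Proof. by rewrite /sqdist /=; ring. Qed.

Lemma no_equilateral a p q r : 0 < a ->
  sqdist p q = a -> sqdist q r = a -> sqdist p r = a -> False.
Proof.
move=> a_gt0 pq qr pr; have := sqdist_heron p q r; rewrite pq qr pr.
set D := _ * _ - _ => e.
suff a0 : a = 0 by rewrite a0 in a_gt0.
apply: (@prime_mul_sqrz_eq0 3 8 a D) => //.
by rewrite -[RHS](addrK ((a + a - a) ^+ 2)) e; ring.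
Qed.

Lemma no_square a b p q r s : 0 < a -> 0 < b ->
  sqdist p q = a -> sqdist q r = a -> sqdist r s = a -> sqdist p s = a ->
  sqdist p r = b -> sqdist q s = b -> False.
Proof.
move=> a_gt0 b_gt0 pq qr rs ps pr qs.
have := sqdist_cayley_menger p q r s; rewrite /= pq qr rs ps pr qs => cm.
(* The determinant factors as [2 * b ^+ 2 * (2 * a - b)], so the angle at [p] is right. *)
have eb : b = 2 * a.
  have /eqP : 2 * b ^+ 2 * (2 * a - b) = 0 by rewrite -cm; ring.
  by rewrite !mulf_eq0 /= (gt_eqF b_gt0) /= subr_eq0 => /eqP.
have := sqdist_heron p q s; rewrite pq ps qs eb.
set D := _ * _ - _ => e.
suff D0 : D = 0 by rewrite D0 in e; nia.
apply: (@prime_mul_sqrz_eq0 2 1 D a) => //; apply: (@mulfI _ 4) => //.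
by transitivity (8 * D ^+ 2 + (a + a - 2 * a) ^+ 2); [ring | rewrite e; ring].
Qed.

Lemma no_pentagon_path a b p q r s : 0 < a -> 0 < b ->
  sqdist p q = a -> sqdist q r = a -> sqdist r s = a ->
  sqdist p r = b -> sqdist q s = b -> sqdist p s = b -> False.
Proof.
move=> a_gt0 b_gt0 pq qr rs pr qs ps.
have := sqdist_cayley_menger p q r s; rewrite /= pq qr rs ps pr qs => cm.
(* The determinant is [(a + b) * (3 * a * b - a ^+ 2 - b ^+ 2)]; the factor 4 completes the square.
   The roots [b / a] are the square of the golden ratio and its inverse. *)
have /eqP : (a + b) * (5 * a ^+ 2 - (2 * b - 3 * a) ^+ 2) = 0.
  by rewrite -[RHS](mulr0 4) -cm; ring.
rewrite mulf_eq0 (gt_eqF (addr_gt0 a_gt0 b_gt0)) subr_eq0 => /eqP e.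
suff a0 : a = 0 by rewrite a0 in a_gt0.
by apply: (@prime_mul_sqrz_eq0 5 1 a (2 * b - 3 * a)); rewrite // mul1r.
Qed.

Lemma no_two_distances a b p q r s : uniq [:: p; q; r; s] ->
  {in [:: p; q; r; s] &, forall x y, x != y ->
     sqdist x y = a \/ sqdist x y = b} -> False.
Proof.
rewrite /= !inE !negb_or !andbT.
move=> /and3P[/and3P[npq npr nps] /andP[nqr nqs] nrs] H.
(* A nonpositive value is never attained by distinct points, so it may be replaced by 1. *)
wlog [a_gt0 b_gt0] : a b H / 0 < a /\ 0 < b.
  move=> wl; pose pos (c : int) := if 0 < c then c else 1.
  have posE x y c : x != y -> sqdist x y = c -> sqdist x y = pos c.
    by move=> /sqdist_gt0 + e; rewrite e /pos => ->.
  apply: (wl (pos a) (pos b)); last by rewrite /pos; split; case: ifP.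
  by move=> x y xs ys nxy; case: (H x y xs ys nxy) => e;
    [left | right]; apply: posE.
have E x y : x \in [:: p; q; r; s] -> y \in [:: p; q; r; s] -> x != y ->
    (sqdist x y = a /\ sqdist y x = a) \/ (sqdist x y = b /\ sqdist y x = b).
  by move=> xs ys nxy; rewrite (sqdistC y x); case: (H x y xs ys nxy); tauto.
(* All 64 colourings are enumerated. Three edges of one colour at a vertex force a monochromatic
   triangle; otherwise each vertex has degree 1 or 2 in each colour, which leaves a 4-cycle with its
   diagonals or two paths. *)
have [[? ?]|[? ?]] := E p q ltac:(by rewrite !inE eqxx ?orbT)
                            ltac:(by rewrite !inE eqxx ?orbT) npq;
have [[? ?]|[? ?]] := E p r ltac:(by rewrite !inE eqxx ?orbT)
                            ltac:(by rewrite !inE eqxx ?orbT) npr;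
have [[? ?]|[? ?]] := E p s ltac:(by rewrite !inE eqxx ?orbT)
                            ltac:(by rewrite !inE eqxx ?orbT) nps;
have [[? ?]|[? ?]] := E q r ltac:(by rewrite !inE eqxx ?orbT)
                            ltac:(by rewrite !inE eqxx ?orbT) nqr;
have [[? ?]|[? ?]] := E q s ltac:(by rewrite !inE eqxx ?orbT)
                            ltac:(by rewrite !inE eqxx ?orbT) nqs;
have [[? ?]|[? ?]] := E r s ltac:(by rewrite !inE eqxx ?orbT)
                            ltac:(by rewrite !inE eqxx ?orbT) nrs;
clear E H;
match goal with
| h1 : sqdist ?x ?y = ?c, h2 : sqdist ?y ?z = ?c, h3 : sqdist ?x ?z = ?c |- _ =>
    apply: (no_equilateral _ h1 h2 h3)
| h1 : sqdist ?x ?y = ?c, h2 : sqdist ?y ?z = ?c, h3 : sqdist ?z ?t = ?c,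
  h4 : sqdist ?x ?t = ?c, h5 : sqdist ?x ?z = ?d, h6 : sqdist ?y ?t = ?d |- _ =>
    apply: (no_square _ _ h1 h2 h3 h4 h5 h6)
| h1 : sqdist ?x ?y = ?c, h2 : sqdist ?y ?z = ?c, h3 : sqdist ?z ?t = ?c,
  h4 : sqdist ?x ?z = ?d, h5 : sqdist ?y ?t = ?d, h6 : sqdist ?x ?t = ?d |- _ =>
    apply: (no_pentagon_path _ _ h1 h2 h3 h4 h5 h6)
end; assumption.
Qed.

Definition grid_pt (R : realType) (p : int * int) : 'rV[R]_2 :=
  vec2 p.1%:~R (Num.sqrt 2 * p.2%:~R).

Lemma edist_grid_pt (R : realType) (p q : int * int) :
  edist (grid_pt R p) (grid_pt R q) = Num.sqrt (sqdist p q)%:~R.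
Proof.
rewrite /edist big_ord_recl big_ord1 !mxE /=; congr Num.sqrt.
rewrite -mulrBr exprMn sqr_sqrtr ?ler0n // /sqdist.
by rewrite rmorphD rmorphM !rmorphXn !rmorphB.
Qed.

(** Two arbitrary real candidates for the distances thus yield two integer candidates for
    [sqdist]. *)
Lemma sqdistE (R : realType) (p q : int * int) :
  sqdist p q = Num.floor (edist (grid_pt R p) (grid_pt R q) ^+ 2).
Proof. by rewrite edist_grid_pt sqr_sqrtr ?ler0z ?sqdist_ge0 // intrKfloor. Qed.

Lemma grid_pt_inj (R : realType) : injective (grid_pt R).
Proof.
move=> p q epq; apply/eqP; apply/negPn/negP => /sqdist_gt0.
by rewrite (sqdistE R) epq -sqdistE /sqdist !subrr.
Qed.

Lemma fset_card_le2 (K : choiceType) (x0 : K) (A : {fset K}) :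
  (#|` A|%fset <= 2)%N ->
  exists a b, forall x, x \in A -> x = a \/ x = b.
Proof.
(* When [A] has fewer than two elements, [nth] falls back on [x0], which need not lie in [A]. *)
move=> A_le2; exists (nth x0 A 0), (nth x0 A 1) => x xA.
have xi : nth x0 A (index x A) = x by apply: nth_index.
have : (index x A < 2)%N by apply: leq_trans A_le2; rewrite index_mem.
by case: (index x A) xi => [|[|]] //= <- _; [left | right].
Qed.

Theorem theorem4p1 (R : realType) (m : nat) (hm : (1 <= m)%N)
    (S : {fset 'rV[R]_2}) (hS : ([set` S] `<=` grid m)%classic)
    (hcard : #|` S|%fset = 4) :
  (3 <= #|` distances S|%fset)%N.
Proof.
rewrite ltnNge; apply/negP => /(fset_card_le2 0)[a [b ab]].
(* Lifting the whole enumeration to index pairs lets size and absence of repetitions pass to [t]. *)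
have [t eS] : exists t : seq (int * int), map (grid_pt R) t = enum_fset S.
  have : {in enum_fset S, forall x, exists p, x = grid_pt R p}.
    by move=> x /hS[i [j [_ _ ->]]]; exists (i, j).
  elim: (enum_fset S) => [|x s IHs] sP; first by exists [::].
  have [p ->] := sP x (mem_head _ _).
  have [t <-] : exists t, map (grid_pt R) t = s.
    by apply: IHs => y ys; apply: sP; rewrite inE ys orbT.
  by exists (p :: t).
have t_uniq : uniq t by rewrite -(map_inj_uniq (@grid_pt_inj R)) eS fset_uniq.
have : size t = 4%N by rewrite -(size_map (grid_pt R)) eS.
have tP : {in t &, forall x y, x != y ->
    sqdist x y = Num.floor (a ^+ 2) \/ sqdist x y = Num.floor (b ^+ 2)}.
  move=> x y xt yt nxy; rewrite (sqdistE R).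
  have inS z : z \in t -> grid_pt R z \in S.
    by move=> zt; rewrite -[_ \in S]/(_ \in enum_fset S) -eS map_f.
  have [|->|->] := ab (edist (grid_pt R x) (grid_pt R y)); [|by left|by right].
  apply/imfset2P; exists (grid_pt R x); first exact: inS.
  exists (grid_pt R y) => //; rewrite !inE inS //=.
  by rewrite (inj_eq (@grid_pt_inj R)).
move: t_uniq tP; clear eS; move: t => [|p [|q [|r [|s []]]]] // t_uniq tP _.
exact: no_two_distances t_uniq tP.
Qed.
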